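(* Let $q$ and $z$ be indeterminates. For every integer $L\ge 0$, $$\sum_{n=0}^L q^{T_n}\,\frac{z^{-n}+z^{1+n}}{1+z}=\sum_{i,j,k\ge 0} q^{T_i+T_j+T_k}\,z^{i-j}(-1)^k\begin{bmatrix}L-i\\ j\end{bmatrix}_q\begin{bmatrix}L-j\\ k\end{bmatrix}_q\begin{bmatrix}L-k\\ i\end{bmatrix}_q .$$
   Context: Notation: $T_n=\frac{n(n+1)}{2}$. For an integer $N\ge 0$, $(a)_N=(a;q)_N=\prod_{j=0}^{N-1}(1-aq^j)$ with $(a)_0=1$. The $q$-binomial coefficient is defined by $\begin{bmatrix}n+m\\ n\end{bmatrix}_q=\frac{(q)_{n+m}}{(q)_n(q)_m}$ if $n,m\ge 0$, and $0$ otherwise; i.e. $\begin{bmatrix}M\\ n\end{bmatrix}_q=0$ unless $0\le n\le M$. Thus the sum over $i,j,k$ is finite. *)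

(* Defs.v *)
From HB Require Import structures.
From mathcomp Require Import all_boot all_order all_algebra.
From mathcomp Require Import zify.
From mathcomp Require Import boolp classical_sets functions cardinality fsbigop.

Set Implicit Arguments.
Unset Strict Implicit.
Unset Printing Implicit Defensive.
Import Order.TTheory GRing.Theory Num.Theory.
Local Open Scope ring_scope.

(* R(q, z), for a coefficient domain R, is the fraction field of R[q][z]:
   z is the outer variable and q the inner one. *)
Definition ratfun2 (R : idomainType) : fieldType := {fraction {poly {poly R}}}.
Definition qvar (R : idomainType) : ratfun2 R := FracField.tofrac ('X%:P).
Definition zvar (R : idomainType) : ratfun2 R := FracField.tofrac 'X.

Definition triangular (n : nat) : nat := (n * n.+1) %/ 2.

Definition qpoch (K : pzRingType) (a q : K) (N : nat) : K :=
  \prod_(0 <= j < N) (1 - a * q ^+ j).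

(* The arguments M and n are integers: for tops such as L - i with i > L,
   truncated subtraction on nat would wrongly give [0 choose 0] = 1. *)
Definition qbinom (K : fieldType) (q : K) (M n : int) : K :=
  if (0 <= n) && (n <= M)
  then qpoch q q `|M|%N / (qpoch q q `|n|%N * qpoch q q `|M - n|%N)
  else 0.

(* A sum \sum_(t \in A) with infinite support is 0 by convention; this bound
   shows that the triple sums over such products are genuinely finite. *)
Lemma qbinom3_support (K : fieldType) (q : K) (L i j k : nat) :
  qbinom q (L%:Z - i%:Z) j * qbinom q (L%:Z - j%:Z) k
    * qbinom q (L%:Z - k%:Z) i != 0 ->
  [/\ (i <= L)%N, (j <= L)%N & (k <= L)%N].
Proof.
rewrite !mulf_eq0 !negb_or /qbinom => /andP[/andP[]].
case: ifP => [h1 _|_]; last by rewrite eqxx.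
case: ifP => [h2 _|_]; last by rewrite eqxx.
case: ifP => [h3 _|_]; last by rewrite eqxx.
by split; lia.
Qed.

(* Main.v *)
Require Import Defs.
From HB Require Import structures.
From mathcomp Require Import all_boot all_order all_algebra.
From mathcomp Require Import zify ring.
From mathcomp Require Import boolp classical_sets functions cardinality fsbigop.

Set Implicit Arguments.
Unset Strict Implicit.
Unset Printing Implicit Defensive.
Import Order.TTheory GRing.Theory Num.Theory.
Local Open Scope classical_set_scope.
Local Open Scope ring_scope.

(** The triple sum collapses in two stages.  Write (q)_n for (q;q)_n.

    For fixed i and j with i + j <= L, the sum over k is a q-analogue of an
    iterated difference.  By the q-binomial theorem, [qdiff q n m i] is the
    operator (E - q)(E - q^2)...(E - q^n), with E the shift of x, applied to
    the function sending x to the Gaussian binomial of x over i and evaluated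
    at x = m.  The q-Pascal rule says that E - q^i lowers i by one, so the
    first i factors turn the binomial into the constant 1, and each remaining
    factor E - q^l multiplies a constant by 1 - q^l; hence the value
    (q)_n / (q)_i ([qdiff_closed]).  Taking n = L - j and m = j, what remains
    is the double sum of the terms z^(i-j) t_L(i, j), with the weight
      t_L(i, j) = q^(T_i + T_j) (q)_(L-i) (q)_(L-j)
                    / ((q)_i (q)_j (q)_(L-i-j)),
    called [pair_weight] below ([sum_qbinom_cyclic]).

    The weights satisfy a recurrence in L:
      t_L(i, j) = (1 - q^L) t_(L-1)(i, j) + q^L t_(L-2)(i-1, j-1),
    which comes from
      (1 - q^(L-i)) (1 - q^(L-j)) - (1 - q^(L-i-j))
        = q^(L-i-j) ((1 - q^i) (1 - q^j) - q^(i+j) (1 - q^(L-i-j)))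
    and fails only at the two corners (L, 0) and (0, L), where q^(T_L) has to
    be added.  Since z^(i-j) is unchanged when i and j both drop by one, the
    double sum S_L satisfies
      S_L = (1 - q^L) S_(L-1) + q^L S_(L-2) + q^(T_L) (z^L + z^(-L))
    ([pair_sum_rec]).  The partial sums of q^(T_n) A_n, with
    A_n = (z^(-n) + z^(n+1)) / (1 + z), satisfy the same recurrence because
    T_L = T_(L-1) + L and A_L + A_(L-1) = z^L + z^(-L) ([alternantS]). *)

(** * Triangular numbers, q-factorials and Gaussian binomials *)

(** The condition under which the q-factorials, which are denominators of the
    Gaussian binomials, do not vanish. *)
Definition no_root_of_unity (K : fieldType) (q : K) : Prop :=
  forall n, 1 - q ^+ n.+1 != 0.

Lemma triangularS (n : nat) : triangular n.+1 = (triangular n + n.+1)%N.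
Proof.
rewrite /triangular; have -> : (n.+1 * n.+2 = n * n.+1 + n.+1 * 2)%N by lia.
by rewrite divnDMl.
Qed.

Lemma triangular0 : triangular 0 = 0%N. Proof. by []. Qed.

Lemma qpoch0 (K : pzRingType) (a q : K) : qpoch a q 0 = 1.
Proof. by rewrite /qpoch big_geq. Qed.

Lemma qpochS (K : fieldType) (q : K) (n : nat) :
  qpoch q q n.+1 = qpoch q q n * (1 - q ^+ n.+1).
Proof. by rewrite /qpoch big_nat_recr //= -exprS. Qed.

Lemma qpoch_neq0 (K : fieldType) (q : K) (n : nat) :
  no_root_of_unity q -> qpoch q q n != 0.
Proof.
move=> nq; elim: n => [|n IHn]; first by rewrite qpoch0 oner_neq0.
by rewrite qpochS mulf_neq0.
Qed.

Lemma qbinomE (K : fieldType) (q : K) (m n : nat) :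
  qbinom q m%:Z n%:Z =
  if (n <= m)%N then qpoch q q m / (qpoch q q n * qpoch q q (m - n)%N) else 0.
Proof.
rewrite /qbinom lez_nat /=; case: ifP => // le_nm.
by have -> : `|m%:Z - n%:Z|%N = (m - n)%N by lia.
Qed.

Lemma qbinom_small (K : fieldType) (q : K) (M : int) (n : nat) :
  M < n%:Z -> qbinom q M n%:Z = 0.
Proof. by rewrite /qbinom => ltMn; rewrite ifF //; lia. Qed.

Lemma qbinom0 (K : fieldType) (q : K) (m : nat) :
  no_root_of_unity q -> qbinom q m%:Z 0%:Z = 1.
Proof. by move=> nq; rewrite qbinomE subn0 qpoch0 mul1r divff ?qpoch_neq0. Qed.

Lemma qbinom_diag (K : fieldType) (q : K) (m : nat) :
  no_root_of_unity q -> qbinom q m%:Z m%:Z = 1.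
Proof. by move=> nq; rewrite qbinomE leqnn subnn qpoch0 mulr1 divff ?qpoch_neq0. Qed.

Lemma qbinom_pascal_low (K : fieldType) (q : K) (m i : nat) :
  no_root_of_unity q ->
  qbinom q m.+1%:Z i.+1%:Z =
  q ^+ i.+1 * qbinom q m%:Z i.+1%:Z + qbinom q m%:Z i%:Z.
Proof.
move=> nq; case: (ltngtP m i) => [lt_mi|lt_im|->].
- by rewrite !qbinom_small ?mulr0 ?addr0 //; lia.
- have [d ->] : exists d, m = (d + i.+1)%N by exists (m - i.+1)%N; lia.
  rewrite !qbinomE !ifT; try lia.
  have -> : ((d + i.+1).+1 - i.+1 = d.+1)%N by lia.
  have -> : (d + i.+1 - i.+1 = d)%N by lia.
  have -> : (d + i.+1 - i = d.+1)%N by lia.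
  rewrite !qpochS !exprS exprD exprS.
  move: (nq d) (nq i) (qpoch_neq0 d nq) (qpoch_neq0 i nq).
  by rewrite !exprS => *; field; apply/and4P.
rewrite (@qbinom_small _ _ i%:Z); last by lia.
by rewrite !qbinom_diag // mulr0 add0r.
Qed.

Lemma qbinom_pascal_high (K : fieldType) (q : K) (n k : nat) :
  no_root_of_unity q -> (k <= n)%N ->
  qbinom q n.+1%:Z k.+1%:Z =
  qbinom q n%:Z k.+1%:Z + q ^+ (n - k)%N * qbinom q n%:Z k%:Z.
Proof.
move=> nq; rewrite leq_eqVlt => /predU1P[->|lt_kn].
  rewrite (@qbinom_small _ _ n%:Z); last by lia.
  by rewrite !qbinom_diag // subnn add0r mulr1.
have [d ->] : exists d, n = (d + k.+1)%N by exists (n - k.+1)%N; lia.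
rewrite !qbinomE !ifT; try lia.
have -> : ((d + k.+1).+1 - k.+1 = d.+1)%N by lia.
have -> : (d + k.+1 - k.+1 = d)%N by lia.
have -> : (d + k.+1 - k = d.+1)%N by lia.
rewrite !qpochS !exprS exprD exprS.
move: (nq d) (nq k) (qpoch_neq0 d nq) (qpoch_neq0 k nq).
by rewrite !exprS => *; field; apply/and4P.
Qed.

(** * The inner sum as an iterated q-difference *)

(** The expansion, by the q-binomial theorem, of the product of the operators
    E - q^l for 1 <= l <= n, where E shifts m by one, applied to the Gaussian
    binomial of m over i. *)
Definition qdiff (K : fieldType) (q : K) (n m i : nat) : K :=
  \sum_(0 <= k < n.+1)
    (-1) ^+ k * q ^+ triangular k * qbinom q n%:Z k%:Z
    * qbinom q (m + n - k)%N%:Z i%:Z.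

(** This splits off the factor E - q^(n+1): the q-Pascal rule in the upper
    index n separates the part shifted by E from the part scaled by q^(n+1). *)
Lemma qdiffS (K : fieldType) (q : K) (n m i : nat) :
  no_root_of_unity q ->
  qdiff q n.+1 m i = qdiff q n m.+1 i - q ^+ n.+1 * qdiff q n m i.
Proof.
move=> nq; rewrite /qdiff big_nat_recl //=.
under eq_big_nat => k /andP[_ lt_kn].
  rewrite qbinom_pascal_high // mulrDr mulrDl.
  over.
rewrite big_split /= addrA; congr (_ + _).
  transitivity (\sum_(0 <= k < n.+2)
    (-1) ^+ k * q ^+ triangular k * qbinom q n%:Z k%:Z
      * qbinom q (m.+1 + n - k)%N%:Z i%:Z).
    rewrite [RHS]big_nat_recl //= !qbinom0 // addnS addSn; congr (_ + _).
  rewrite big_nat_recr //= (@qbinom_small _ q n n.+1); last by lia.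
  by rewrite mulr0 mul0r addr0.
rewrite mulr_sumr -sumrN; apply: eq_big_nat => k /andP[_ lt_kn].
have -> : (m + n.+1 - k.+1 = m + n - k)%N by lia.
rewrite triangularS.
have -> : q ^+ n.+1 = q ^+ (n - k) * q ^+ k.+1 by rewrite -exprD; congr (_ ^+ _); lia.
by rewrite exprD [(-1) ^+ k.+1]exprS; ring.
Qed.

(** The operator E - q^(i+1) lowers the index i of a Gaussian binomial by one,
    and this survives the linear combination defining [qdiff]. *)
Lemma qdiff_pascal (K : fieldType) (q : K) (n m i : nat) :
  no_root_of_unity q ->
  qdiff q n m.+1 i.+1 = q ^+ i.+1 * qdiff q n m i.+1 + qdiff q n m i.
Proof.
move=> nq; rewrite /qdiff mulr_sumr -big_split; apply: eq_big_nat => k /andP[_ lt_kn].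
have -> : (m.+1 + n - k = (m + n - k).+1)%N by lia.
by rewrite qbinom_pascal_low //=; ring.
Qed.

(** The value does not depend on m.  In the induction on n, for i <= n the new
    factor E - q^(n+1) acts on a constant and multiplies it by 1 - q^(n+1); for
    i = n + 1 it lowers the index i to n, where the quotient is 1. *)
Lemma qdiff_closed (K : fieldType) (q : K) (n m i : nat) :
  no_root_of_unity q -> (i <= n)%N ->
  qdiff q n m i = qpoch q q n / qpoch q q i.
Proof.
move=> nq; elim: n m i => [|n IHn] m i.
  rewrite leqn0 => /eqP->; rewrite /qdiff big_nat1 triangular0 !qbinom0 //.
  by rewrite qpoch0 divr1 !mulr1.
rewrite leq_eqVlt qdiffS // => /predU1P[->|le_in]; last first.
  by rewrite !IHn // qpochS; ring.
by rewrite qdiff_pascal // addrAC subrr add0r IHn // !divff ?qpoch_neq0.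
Qed.

(** * The double sum and its recurrence *)

(** What is left of the cyclic product of three Gaussian binomials once the
    third index has been summed out.  The test is needed: for i + j > L the
    truncated subtractions would give spurious nonzero values. *)
Definition pair_weight (K : fieldType) (q : K) (L i j : nat) : K :=
  if (i + j <= L)%N then
    q ^+ (triangular i + triangular j) * (qpoch q q (L - i) * qpoch q q (L - j))
    / (qpoch q q i * qpoch q q j * qpoch q q (L - i - j))
  else 0.

(** Up to a factor free of k, the sum over k is [qdiff q (L - j) j i]; when
    i + j <= L the closed form applies, and otherwise the binomial of L - i
    over j is zero. *)
Lemma sum_qbinom_cyclic (K : fieldType) (q : K) (L i j : nat) :
  no_root_of_unity q -> (i <= L)%N -> (j <= L)%N ->
  \sum_(0 <= k < L.+1)
     q ^+ (triangular i + triangular j + triangular k) * (-1) ^+ k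
     * qbinom q (L%:Z - i%:Z) j%:Z * qbinom q (L%:Z - j%:Z) k%:Z
     * qbinom q (L%:Z - k%:Z) i%:Z
  = pair_weight q L i j.
Proof.
move=> nq le_iL le_jL; rewrite /pair_weight; case: leqP => [le_ijL|lt_Lij]; last first.
  by rewrite big1 // => k _; rewrite (@qbinom_small _ q (L%:Z - i%:Z)) ?mulr0 ?mul0r //; lia.
rewrite (@big_cat_nat _ _ _ (L - j).+1) //=; try lia.
rewrite [X in _ + X]big_nat_cond [X in _ + X]big1 ?addr0; last first.
  move=> k /andP[/andP[lt_k _] _].
  by rewrite (@qbinom_small _ q (L%:Z - j%:Z)) ?mulr0 ?mul0r //; lia.
transitivity (q ^+ (triangular i + triangular j) * qbinom q (L - i)%N%:Z j%:Z
   * qdiff q (L - j) j i).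
  rewrite /qdiff mulr_sumr; apply: eq_big_nat => k /andP[_ lt_k].
  have -> : L%:Z - i%:Z = (L - i)%N%:Z by lia.
  have -> : L%:Z - j%:Z = (L - j)%N%:Z by lia.
  have -> : L%:Z - k%:Z = (j + (L - j) - k)%N%:Z by lia.
  by rewrite [q ^+ (_ + triangular k)]exprD; ring.
rewrite qdiff_closed //; last by lia.
rewrite qbinomE ifT; last by lia.
by field; rewrite !qpoch_neq0.
Qed.

Lemma pair_weightC (K : fieldType) (q : K) (L i j : nat) :
  pair_weight q L i j = pair_weight q L j i.
Proof.
rewrite /pair_weight addnC [(triangular j + _)%N]addnC.
by rewrite [qpoch q q (L - i) * _]mulrC [qpoch q q i * _]mulrC (subnAC L i j).
Qed.

(** The edge of the recurrence, where the term with both indices lowered is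
    absent; the corner j = L + 1 supplies the inhomogeneous term. *)
Lemma pair_weight_recl0 (K : fieldType) (q : K) (L j : nat) :
  no_root_of_unity q ->
  pair_weight q L.+1 0 j =
  (1 - q ^+ L.+1) * pair_weight q L 0 j
  + (if j == L.+1 then q ^+ triangular L.+1 else 0).
Proof.
move=> nq; rewrite /pair_weight !add0n !subn0 qpoch0 !mul1r.
case: (ltngtP j L.+1) => [lt_j|lt_j|->].
- rewrite -ltnS lt_j addr0 (qpochS q L).
  by field; rewrite !qpoch_neq0.
- by rewrite !ifF ?mulr0 ?addr0 //; lia.
rewrite subnn qpoch0 ltnn mulr0 add0r !mulr1.
by rewrite mulfK // qpoch_neq0.
Qed.

(** Away from the edges the recurrence is an identity between rational functions
    for i + j < L.  For i + j = L the weight of order L + 1 vanishes and the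
    recurrence reduces to the one for triangular numbers. *)
Lemma pair_weight_recS (K : fieldType) (q : K) (L i j : nat) :
  no_root_of_unity q ->
  pair_weight q L.+2 i.+1 j.+1 =
  (1 - q ^+ L.+2) * pair_weight q L.+1 i.+1 j.+1
  + q ^+ L.+2 * pair_weight q L i j.
Proof.
move=> nq; rewrite /pair_weight !addSn !addnS !ltnS.
case: (ltngtP (i + j) L) => [lt_ijL|lt_Lij|eq_ijL].
- have [d ->] : exists d, L = (d + i + j).+1%N by exists (L - (i + j).+1)%N; lia.
  have -> : ((d + i + j).+3 - i.+1 = (d + j).+2)%N by lia.
  have -> : ((d + i + j).+3 - j.+1 = (d + i).+2)%N by lia.
  have -> : ((d + j).+2 - j.+1 = d.+1)%N by lia.
  have -> : ((d + i + j).+2 - i.+1 = (d + j).+1)%N by lia.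
  have -> : ((d + i + j).+2 - j.+1 = (d + i).+1)%N by lia.
  have -> : ((d + j).+1 - j.+1 = d)%N by lia.
  have -> : ((d + i + j).+1 - i = (d + j).+1)%N by lia.
  have -> : ((d + i + j).+1 - j = (d + i).+1)%N by lia.
  have -> : ((d + j).+1 - j = d.+1)%N by lia.
  rewrite !qpochS !triangularS.
  move: (nq d) (nq i) (nq j) (qpoch_neq0 d nq) (qpoch_neq0 i nq) (qpoch_neq0 j nq).
  by rewrite !exprD !exprS !exprD => *; field; do !(apply/andP; split).
- by rewrite !mulr0 addr0.
subst L; have -> : ((i + j).+2 - i.+1 = j.+1)%N by lia.
have -> : ((i + j).+2 - j.+1 = i.+1)%N by lia.
have -> : (i + j - i = j)%N by lia.
have -> : (i + j - j = i)%N by lia.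
rewrite !subnn qpoch0 !triangularS mulr0 add0r.
have := qpoch_neq0 i nq; have := qpoch_neq0 j nq.
have := qpoch_neq0 i.+1 nq; have := qpoch_neq0 j.+1 nq.
have -> : (triangular i + i.+1 + (triangular j + j.+1) =
  (i + j).+2 + (triangular i + triangular j))%N by lia.
by rewrite exprD => *; field; apply/and4P.
Qed.

Definition pair_sum (K : fieldType) (q x y : K) (L : nat) : K :=
  \sum_(0 <= i < L.+1) \sum_(0 <= j < L.+1) pair_weight q L i j * (x ^+ i * y ^+ j).

(** Enlarging the box lets sums of different orders L be compared term by
    term. *)
Lemma pair_sum_widen (K : fieldType) (q x y : K) (L N : nat) : (L <= N)%N ->
  pair_sum q x y L =
  \sum_(0 <= i < N.+1) \sum_(0 <= j < N.+1) pair_weight q L i j * (x ^+ i * y ^+ j).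
Proof.
move=> le_LN.
have w0 i j : (L < i + j)%N -> pair_weight q L i j * (x ^+ i * y ^+ j) = 0.
  by move=> lt_L; rewrite /pair_weight leqNgt lt_L mul0r.
rewrite [RHS](@big_cat_nat _ _ _ L.+1) //= [X in _ + X]big_nat_cond.
rewrite [X in _ + X]big1 ?addr0; last first.
  by move=> i /andP[/andP[lt_i _] _]; apply: big1 => j _; apply: w0; lia.
apply: eq_big_nat => i _.
rewrite [RHS](@big_cat_nat _ _ _ L.+1) //= [X in _ + X]big_nat_cond.
rewrite [X in _ + X]big1 ?addr0 //.
by move=> j /andP[/andP[lt_j _] _]; apply: w0; lia.
Qed.

(** The square of indices splits into its row i = 0, its column j = 0 and the
    rest.  The row and the column each contribute one inhomogeneous term; on the
    rest x^i y^j is unchanged under the diagonal shift, because x y = 1. *)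
Lemma pair_sum_rec (K : fieldType) (q x y : K) (L : nat) :
  no_root_of_unity q -> x * y = 1 ->
  pair_sum q x y L.+2 =
  (1 - q ^+ L.+2) * pair_sum q x y L.+1 + q ^+ L.+2 * pair_sum q x y L
  + q ^+ triangular L.+2 * (x ^+ L.+2 + y ^+ L.+2).
Proof.
move=> nq xy1.
rewrite (@pair_sum_widen _ _ _ _ L L.+1) // (@pair_sum_widen _ _ _ _ L.+1 L.+2) //.
rewrite /pair_sum.
have split_edges (f : nat -> nat -> K) N :
    \sum_(0 <= i < N.+1) \sum_(0 <= j < N.+1) f i j =
    \sum_(0 <= j < N.+1) f 0%N j + \sum_(0 <= i < N) f i.+1 0%N
    + \sum_(0 <= i < N) \sum_(0 <= j < N) f i.+1 j.+1.
  rewrite big_nat_recl // -addrA -big_split /=; congr (_ + _).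
  by apply: eq_bigr => i _; rewrite big_nat_recl.
have edge (u : K) :
    \sum_(0 <= j < L.+3) pair_weight q L.+2 0 j * u ^+ j =
    (1 - q ^+ L.+2) * (\sum_(0 <= j < L.+3) pair_weight q L.+1 0 j * u ^+ j)
    + q ^+ triangular L.+2 * u ^+ L.+2.
  rewrite mulr_sumr [LHS]big_nat_recr //= [X in X + _ = _]big_nat_cond.
  rewrite [RHS](_ : _ = \sum_(0 <= j < L.+2) (1 - q ^+ L.+2) *
    (pair_weight q L.+1 0 j * u ^+ j) + (1 - q ^+ L.+2) *
    (pair_weight q L.+1 0 L.+2 * u ^+ L.+2)
    + q ^+ triangular L.+2 * u ^+ L.+2); last by rewrite big_nat_recr.
  rewrite -addrA; congr (_ + _).
    rewrite [RHS]big_nat_cond; apply: eq_bigr => j /andP[/andP[_ lt_j] _].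
    by rewrite pair_weight_recl0 // ifF ?addr0 ?mulrA //; lia.
  by rewrite pair_weight_recl0 // eqxx; ring.
(* The same with the corner (0, 0) removed, so that it is counted only once. *)
have edge0 (u : K) :
    \sum_(0 <= i < L.+2) pair_weight q L.+2 0 i.+1 * u ^+ i.+1 =
    (1 - q ^+ L.+2) * (\sum_(0 <= i < L.+2) pair_weight q L.+1 0 i.+1 * u ^+ i.+1)
    + q ^+ triangular L.+2 * u ^+ L.+2.
  have := edge u; rewrite !(big_nat_recl L.+2) //.
  rewrite pair_weight_recl0 //= addr0 !mulr1 mulrDr -!addrA; exact: addrI.
have inner :
    \sum_(0 <= i < L.+2) \sum_(0 <= j < L.+2)
      pair_weight q L.+2 i.+1 j.+1 * (x ^+ i.+1 * y ^+ j.+1) =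
    (1 - q ^+ L.+2) * (\sum_(0 <= i < L.+2) \sum_(0 <= j < L.+2)
      pair_weight q L.+1 i.+1 j.+1 * (x ^+ i.+1 * y ^+ j.+1))
    + q ^+ L.+2 * (\sum_(0 <= i < L.+2) \sum_(0 <= j < L.+2)
      pair_weight q L i j * (x ^+ i * y ^+ j)).
  rewrite !mulr_sumr -big_split; apply: eq_bigr => i _ /=.
  rewrite !mulr_sumr -big_split; apply: eq_bigr => j _ /=.
  have -> : x ^+ i.+1 * y ^+ j.+1 = x ^+ i * y ^+ j.
    by rewrite !exprS mulrACA xy1 mul1r.
  by rewrite pair_weight_recS //; ring.
have row0 M : \sum_(0 <= j < L.+3) pair_weight q M 0 j * (x ^+ 0 * y ^+ j) =
    \sum_(0 <= j < L.+3) pair_weight q M 0 j * y ^+ j.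
  by apply: eq_bigr => j _; rewrite mul1r.
have col0 M :
    \sum_(0 <= i < L.+2) pair_weight q M i.+1 0 * (x ^+ i.+1 * y ^+ 0) =
    \sum_(0 <= i < L.+2) pair_weight q M 0 i.+1 * x ^+ i.+1.
  by apply: eq_bigr => i _; rewrite mulr1 pair_weightC.
rewrite !(split_edges _ L.+2) !row0 !col0 edge edge0 inner.
ring.
Qed.

(** * The partial theta sum *)

(** The Laurent polynomial z^(-n) - z^(1-n) + ... + z^n. *)
Definition alternant (K : fieldType) (z : K) (n : nat) : K :=
  (z ^- n + z ^+ (1 + n)) / (1 + z).

Lemma alternant0 (K : fieldType) (z : K) : 1 + z != 0 -> alternant z 0 = 1.
Proof. by move=> nz; rewrite /alternant expr0 invr1 divff. Qed.

Lemma alternantS (K : fieldType) (z : K) (n : nat) :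
  z != 0 -> 1 + z != 0 ->
  alternant z n.+1 + alternant z n = z ^+ n.+1 + z^-1 ^+ n.+1.
Proof.
move=> z0 nz; rewrite /alternant exprVn !add1n !exprS.
by field; rewrite nz z0 expf_neq0.
Qed.

Lemma pair_sum_closed (K : fieldType) (q z : K) (L : nat) :
  no_root_of_unity q -> z != 0 -> 1 + z != 0 ->
  pair_sum q z z^-1 L = \sum_(0 <= n < L.+1) q ^+ triangular n * alternant z n.
Proof.
move=> nq z0 nz.
have w0 : pair_weight q 0 0 0 = 1.
  by rewrite /pair_weight /= !qpoch0 !mulr1 divr1.
have S0 : pair_sum q z z^-1 0 = 1 by rewrite /pair_sum !big_nat1 w0 !mulr1.
have S1 : pair_sum q z z^-1 1 = 1 - q + q * (z + z^-1).
  rewrite /pair_sum; do 3!rewrite big_nat_recr //= big_nat1.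
  rewrite (pair_weightC q 1 1 0) !(pair_weight_recl0 0) //= w0.
  by rewrite /pair_weight /= triangularS triangular0 !add0n !expr1; ring.
(* The recurrence has order two, so two consecutive values are carried. *)
suff [] : pair_sum q z z^-1 L =
    \sum_(0 <= n < L.+1) q ^+ triangular n * alternant z n /\
  pair_sum q z z^-1 L.+1 =
    \sum_(0 <= n < L.+2) q ^+ triangular n * alternant z n by [].
have alt n : alternant z n.+1 = z ^+ n.+1 + z^-1 ^+ n.+1 - alternant z n.
  by rewrite -alternantS // addrK.
elim: L => [|L [IH0 IH1]].
  split; first by rewrite S0 big_nat1 alternant0 // triangular0 mulr1.
  rewrite S1 big_nat_recr //= big_nat1 alt alternant0 // triangularS triangular0.
  by rewrite !expr1; ring.
split=> //; rewrite pair_sum_rec ?divff // IH0 IH1.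
rewrite [RHS](big_nat_recr L.+2) //= alt !(big_nat_recr L.+1) //=.
by rewrite [triangular L.+2]triangularS exprD; ring.
Qed.

(** * The triple sum *)

Lemma fsbig_triple_box (V : nmodType) (f : nat * nat * nat -> V) (N : nat) :
  (forall i j k, f (i, j, k) != 0 -> [/\ (i < N)%N, (j < N)%N & (k < N)%N]) ->
  \sum_(t \in [set: nat * nat * nat]) f t =
  \sum_(0 <= i < N) \sum_(0 <= j < N) \sum_(0 <= k < N) f (i, j, k).
Proof.
move=> supp_f; pose r := allpairs pair (allpairs pair (iota 0 N) (iota 0 N)) (iota 0 N).
rewrite (@fsbigE _ _ _ _ _ r).
- rewrite (eq_bigl xpredT); last by move=> t; rewrite in_setT.
  by rewrite !big_allpairs /index_iota subn0.
- by rewrite !allpairs_uniq ?iota_uniq //; move=> [? ?] [? ?].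
- by [].
move=> [[i j] k] _; apply: contraNeq => /supp_f[lt_i lt_j lt_k].
by rewrite !allpairs_f // mem_iota.
Qed.

Lemma cyclic_qbinom_sum (K : fieldType) (q z : K) (L : nat) :
  no_root_of_unity q -> z != 0 -> 1 + z != 0 ->
  \sum_(0 <= n < L.+1)
     q ^+ triangular n * ((z ^- n + z ^+ (1 + n)) / (1 + z)) =
  \sum_(t \in [set: nat * nat * nat])
     (let: (i, j, k) := t in
      q ^+ (triangular i + triangular j + triangular k)
      * z ^ (i%:Z - j%:Z) * (-1) ^+ k
      * qbinom q (L%:Z - i%:Z) j%:Z
      * qbinom q (L%:Z - j%:Z) k%:Z
      * qbinom q (L%:Z - k%:Z) i%:Z).
Proof.
move=> nq z0 nz; rewrite -[LHS](pair_sum_closed L nq z0 nz).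
rewrite (@fsbig_triple_box _ _ L.+1); last first.
  move=> i j k; rewrite -2!mulrA mulf_eq0 negb_or => /andP[_].
  by rewrite mulrA => /qbinom3_support.
apply: eq_big_nat => i /andP[_ le_iL]; apply: eq_big_nat => j /andP[_ le_jL].
rewrite -sum_qbinom_cyclic // mulr_suml; apply: eq_bigr => k _.
by rewrite expfzDr // -exprz_inv -!exprnP; ring.
Qed.

(** * The indeterminates q and z *)

Lemma qvar_no_root_of_unity (R : idomainType) : no_root_of_unity (qvar R).
Proof.
move=> n; rewrite /qvar -tofracXn -tofrac1 -tofracB tofrac_eq0 subr_eq0.
rewrite -polyC_exp -polyC1 (inj_eq (@polyC_inj _)).
apply/eqP => /(congr1 (fun p : {poly R} => size p)).
by rewrite size_polyXn size_poly1.
Qed.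

Lemma zvar_neq0 (R : idomainType) : zvar R != 0.
Proof. by rewrite /zvar tofrac_eq0 polyX_eq0. Qed.

Lemma add1_zvar_neq0 (R : idomainType) : 1 + zvar R != 0.
Proof.
rewrite /zvar -tofrac1 -tofracD tofrac_eq0 addrC -polyC1.
by rewrite -size_poly_eq0 size_XaddC.
Qed.

Unset Implicit Arguments.

Theorem mainTheorem1 (R : idomainType) (L : nat) :
  let q := qvar R in
  let z := zvar R in
  \sum_(0 <= n < L.+1)
     q ^+ triangular n * ((z ^- n + z ^+ (1 + n)) / (1 + z)) =
  \sum_(t \in [set: nat * nat * nat])
     (let: (i, j, k) := t in
      q ^+ (triangular i + triangular j + triangular k)
      * z ^ (i%:Z - j%:Z) * (-1) ^+ k
      * qbinom q (L%:Z - i%:Z) j%:Z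
      * qbinom q (L%:Z - j%:Z) k%:Z
      * qbinom q (L%:Z - k%:Z) i%:Z).
Proof.
move=> q z; apply: cyclic_qbinom_sum.
- exact: qvar_no_root_of_unity.
- exact: zvar_neq0.
exact: add1_zvar_neq0.
Qed.
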